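(* For every positive integer $k$ and every constant $\varepsilon>0$, there is no polynomial time algorithm (in the value and independence oracle model) for maximizing a non-negative monotone submodular function over a $k$-extendible system that achieves an approximation ratio of $(1-e^{-1/k})^{-1}-\varepsilon$.
   Context: An independence system on a finite ground set $\mathcal{N}$ of size $n$ is a non-empty family $\mathcal{I}\subseteq2^{\mathcal{N}}$ closed under subsets; it is $k$-extendible if for all $A\subseteq B\in\mathcal{I}$ and $u\notin B$ with $A\cup\{u\}\in\mathcal{I}$ there is $Y\subseteq B\setminus A$, $|Y|\le k$, with $(B\setminus Y)\cup\{u\}\in\mathcal{I}$. $f:2^{\mathcal{N}}\to\mathbb{R}_{\ge0}$ is submodular if $f(X\cup Y)+f(X\cap Y)\le f(X)+f(Y)$ and monotone if $f(A)\le f(B)$ for $A\subseteq B$. The algorithm accesses $f$ only through a value oracle and $\mathcal{I}$ only through an independence oracle; ''polynomial time'' means polynomially many (in $n$) oracle queries; the algorithm may be randomized. An approximation ratio of $\alpha$ means the (expected) value of the output independent set is at least $f(OPT)/\alpha$ on every instance, where $OPT$ maximizes $f$ over $\mathcal{I}$. The hardness is information-theoretic. *)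

(* Defs.v *)
From HB Require Import structures.
From mathcomp Require Import all_boot all_order all_algebra.
From mathcomp Require Import all_classical all_reals all_analysis.

Set Implicit Arguments.
Unset Strict Implicit.
Unset Printing Implicit Defensive.

Import Order.TTheory GRing.Theory Num.Theory.

Local Open Scope ring_scope.

Section Problem.
Variables (R : realType) (T : finType).
Implicit Types (I : {set {set T}}) (f : {set T} -> R).

Definition independence_system I : Prop :=
  (exists A, A \in I) /\
  (forall A B : {set T}, A \subset B -> B \in I -> A \in I).

Definition extendible_system (k : nat) I : Prop :=
  independence_system I /\
  forall (A B : {set T}) (u : T),
    A \subset B -> B \in I -> u \notin B -> A :|: [set u]%SET \in I ->
    exists Y : {set T},
      [/\ Y \subset B :\: A, (#|Y| <= k)%N
        & (B :\: Y) :|: [set u]%SET \in I].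

Definition nonneg_setfun f : Prop := forall X, 0 <= f X.

Definition submodular f : Prop :=
  forall X Y : {set T}, f (X :|: Y) + f (X :&: Y) <= f X + f Y.

Definition monotone_setfun f : Prop :=
  forall A B : {set T}, A \subset B -> f A <= f B.

Definition valid_instance (k : nat) f I : Prop :=
  [/\ nonneg_setfun f, monotone_setfun f, submodular f
    & extendible_system k I].

Definition is_opt f I (O : {set T}) : Prop :=
  O \in I /\ forall S : {set T}, S \in I -> f S <= f O.

(* A deterministic algorithm is an adaptive decision tree: computation between
   queries is free, so that only oracle calls are counted. *)
Inductive oracle_tree : Type :=
| Output of {set T}
| ValueQuery of {set T} & (R -> oracle_tree)
| IndepQuery of {set T} & (bool -> oracle_tree).

Fixpoint run (t : oracle_tree) f I : {set T} :=
  match t with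
  | Output X => X
  | ValueQuery X next => run (next (f X)) f I
  | IndepQuery X next => run (next (X \in I)) f I
  end.

Fixpoint query_count (t : oracle_tree) f I : nat :=
  match t with
  | Output _ => 0%N
  | ValueQuery X next => (query_count (next (f X)) f I).+1
  | IndepQuery X next => (query_count (next (X \in I)) f I).+1
  end.

(* The random bits are drawn in advance from an arbitrary probability space;
   the output, which ranges over the finite type {set T}, has to be a random
   variable whatever the oracles are. *)
Record rand_algorithm : Type := RandAlgorithm {
  seed_display : measure_display;
  seed : measurableType seed_display;
  seed_law : probability seed R;
  strategy : seed -> oracle_tree;
  measurable_run : forall f I (S : {set T}),
        measurable [set w | run (strategy w) f I = S]%classic
}.

Definition expected_value (A : rand_algorithm) f I : \bar R :=
  expectation (seed_law A) (fun w => f (run (@strategy A w) f I)).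

End Problem.

(* The algorithm may depend on the size n of the ground set, which is taken to
   be 'I_n. *)
Definition algorithm (R : realType) : Type := forall n, rand_algorithm R 'I_n.

Definition polynomial_queries (R : realType) (k : nat) (A : algorithm R) :
    Prop :=
  exists p : {poly nat},
    forall n (f : {set 'I_n} -> R) (I : {set {set 'I_n}}),
      valid_instance k f I ->
      forall w : seed (A n), (query_count (strategy w) f I <= p.[n])%N.

Definition outputs_independent (R : realType) (k : nat) (A : algorithm R) :
    Prop :=
  forall n (f : {set 'I_n} -> R) (I : {set {set 'I_n}}),
    valid_instance k f I ->
    forall w : seed (A n), run (strategy w) f I \in I.

(* Positivity of alpha is required because f OPT / alpha would be at most 0
   otherwise, a bound which every algorithm meets. *)
Definition approximation_ratio (R : realType) (k : nat) (A : algorithm R)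
    (alpha : R) : Prop :=
  0 < alpha /\
  forall n (f : {set 'I_n} -> R) (I : {set {set 'I_n}}),
    valid_instance k f I ->
    forall OPT : {set 'I_n}, is_opt f I OPT ->
      ((f OPT / alpha)%:E <= expected_value (A n) f I)%E.

(* Main.v *)
(* The ground set is split into M blocks of h elements, and a hidden set H picks
   one element at random from each block. With x = |S :&: H|, y = |S :\: H| and
   a threshold t = M / D for a large D, the elements of H beyond the first t
   cost only 1/k in the constraint
     y + min(x, t) + max(x - t, 0) / k <= m,   where m = M / k + t,
   and the objective is 1 - max(eta, rho^(y + min(x, t)) (1 - (1 - rho)
   max(x - t, 0))) with rho = exp(- 1 / M). It is submodular because rho^y and
   the remaining factor are nonnegative, decreasing and convex in y and in x.
   The set H is feasible, with value close to 1. A fixed set X satisfies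
   x <= |X| / h + t / 2 outside an event of exponentially small probability; X
   then has x <= t, or is so large that the objective is truncated and X is
   infeasible, and in both cases the oracles answer as if H were empty. Against
   those answers a feasible set has at most m elements and value at most
   1 - exp(- m / M), which is about 1 - exp(- 1 / k). Averaging over H
   contradicts the approximation ratio. *)
Require Import Defs.
From mathcomp Require Import all_boot all_order all_algebra.
From mathcomp Require Import all_classical all_reals all_analysis.
From mathcomp Require Import measurable_realfun fintype finset zify ring lra.

Set Implicit Arguments.
Unset Strict Implicit.
Unset Printing Implicit Defensive.

Import Order.TTheory GRing.Theory Num.Theory.

Local Open Scope ring_scope.

Section ConvexSequences.
Variable R : realDomainType.
Implicit Type a : nat -> R.

Definition convex_seq a : Prop := forall n, a n.+1 - a n <= a n.+2 - a n.+1.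

Lemma convex_seq_increment_le a n d :
  convex_seq a -> a n.+1 - a n <= a (n + d).+1 - a (n + d)%N.
Proof.
move=> a_convex; elim: d => [|d IHd]; first by rewrite addn0.
by rewrite addnS (le_trans IHd).
Qed.

Lemma convex_seq_addD a i p q :
  convex_seq a -> a (i + p)%N + a (i + q)%N <= a i + a (i + p + q)%N.
Proof.
move=> a_convex; elim: q => [|q IHq]; first by rewrite !addn0 addrC.
have := convex_seq_increment_le (i + q) p a_convex.
by rewrite (addnAC i q p) !addnS; lra.
Qed.

Lemma convex_seq_expr (x : R) : 0 <= x -> convex_seq (GRing.exp x).
Proof.
move=> x_ge0 n; rewrite -subr_ge0.
have -> : x ^+ n.+2 - x ^+ n.+1 - (x ^+ n.+1 - x ^+ n) = x ^+ n * (1 - x) ^+ 2.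
  by rewrite !exprS; ring.
by rewrite mulr_ge0 ?sqr_ge0 ?exprn_ge0.
Qed.

End ConvexSequences.

Lemma setDDK (T : finType) (A B : {set T}) : A \subset B -> B :\: (B :\: A) = A.
Proof. by move=> AB; rewrite setDDr setDv set0U (setIidPr AB). Qed.

Lemma cardsDI (T : finType) (S Y H : {set T}) :
  Y \subset S -> (#|(S :\: Y) :&: H| + #|Y :&: H| = #|S :&: H|)%N.
Proof.
move=> YS; rewrite -(cardsID Y (S :&: H)) [RHS]addnC setIDAC.
congr (_ + #|_|)%N.
by rewrite setIAC (setIidPr YS).
Qed.

Lemma cardsIU1 (T : finType) (S H : {set T}) (u : T) :
  u \notin S -> #|(S :|: [set u]) :&: H| = (#|S :&: H| + (u \in H))%N.
Proof.
move=> uS; rewrite -(@cardsDI _ (S :|: [set u]) [set u]) ?subsetUr//.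
have -> : (S :|: [set u]) :\: [set u] = S by rewrite setUC setU1K.
congr (_ + _)%N; rewrite setIC; case: (boolP (u \in H)) => uH.
- by rewrite (setIidPr _) ?sub1set// cards1.
- by apply/eqP; rewrite cards_eq0 setIC setI_eq0 disjoints1.
Qed.

Section SetFunctions.
Variables (R : realType) (T : finType).
Implicit Types (f g : {set T} -> R) (a : nat -> R) (X Y H : {set T}).

Definition antimonotone f : Prop := forall X Y, X \subset Y -> f Y <= f X.

Definition supermodular f : Prop :=
  forall X Y, f X + f Y <= f (X :|: Y) + f (X :&: Y).

Lemma antimonotone_card a : nonincreasing_seq a ->
  antimonotone (fun X => a #|X|).
Proof. by move=> a_homo X Y /subset_leq_card/a_homo. Qed.

Lemma antimonotone_setI f H :
  antimonotone f -> antimonotone (fun X => f (X :&: H)).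
Proof. by move=> f_anti X Y XY; apply/f_anti/setSI. Qed.

Lemma antimonotone_setD f H :
  antimonotone f -> antimonotone (fun X => f (X :\: H)).
Proof. by move=> f_anti X Y XY; apply/f_anti/setSD. Qed.

Lemma antimonotoneM f g : nonneg_setfun f -> nonneg_setfun g ->
  antimonotone f -> antimonotone g -> antimonotone (fun X => f X * g X).
Proof.
by move=> f_ge0 g_ge0 f_anti g_anti X Y XY; rewrite ler_pM ?f_anti ?g_anti.
Qed.

Lemma supermodular_card a : convex_seq a -> supermodular (fun X => a #|X|).
Proof.
move=> a_convex X Y; have cardUI := cardsUI X Y.
have leX := subset_leq_card (subsetIl X Y).
have leY := subset_leq_card (subsetIr X Y).
rewrite [leRHS]addrC; have := convex_seq_addD #|X :&: Y|
  (#|X| - #|X :&: Y|) (#|Y| - #|X :&: Y|) a_convex.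
rewrite !subnKC//; have -> // : (#|X| + (#|Y| - #|X :&: Y|) = #|X :|: Y|)%N.
by lia.
Qed.

Lemma supermodular_setI f H :
  supermodular f -> supermodular (fun X => f (X :&: H)).
Proof. by move=> f_super X Y; rewrite setIUl setIIl; apply: f_super. Qed.

Lemma supermodular_setD f H :
  supermodular f -> supermodular (fun X => f (X :\: H)).
Proof. by move=> f_super X Y; rewrite setDUl setDIl; apply: f_super. Qed.

(* [(f X + f Y - f U) (g X + g Y - g U) <= f I g I] with [U = X :|: Y] and
   [I = X :&: Y]; the cross terms of the left-hand side have the right sign by
   antimonotonicity. *)
Lemma supermodularM f g : nonneg_setfun f -> nonneg_setfun g ->
  antimonotone f -> antimonotone g -> supermodular f -> supermodular g ->
  supermodular (fun X => f X * g X).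
Proof.
move=> f_ge0 g_ge0 f_anti g_anti f_super g_super X Y.
set fU := f (X :|: Y); set fI := f (X :&: Y).
set gU := g (X :|: Y); set gI := g (X :&: Y).
have [fU_leX fU_leY] : fU <= f X /\ fU <= f Y.
  by split; apply: f_anti; rewrite ?subsetUl ?subsetUr.
have [gU_leX gU_leY] : gU <= g X /\ gU <= g Y.
  by split; apply: g_anti; rewrite ?subsetUl ?subsetUr.
have prodI : (f X + f Y - fU) * (g X + g Y - gU) <= fI * gI.
  have [fY_ge0 gY_ge0] := (f_ge0 Y, g_ge0 Y).
  have f_le : f X + f Y <= fU + fI := f_super X Y.
  have g_le : g X + g Y <= gU + gI := g_super X Y.
  by apply: ler_pM; lra.
have crossXY : 0 <= (f X - fU) * (g Y - gU) by rewrite mulr_ge0 ?subr_ge0.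
have crossYX : 0 <= (f Y - fU) * (g X - gU) by rewrite mulr_ge0 ?subr_ge0.
by lra.
Qed.

Lemma submodular_subl_maxr f (b c : R) : antimonotone f -> supermodular f ->
  submodular (fun X => b - Num.max c (f X)).
Proof.
move=> f_anti f_super X Y; have := f_super X Y.
have := f_anti _ _ (subsetUl X Y); have := f_anti _ _ (subsetUr X Y).
have := f_anti _ _ (subsetIl X Y); have := f_anti _ _ (subsetIr X Y).
rewrite !maxEle; case: (leP c (f X)); case: (leP c (f Y));
  by case: (leP c (f (X :|: Y))); case: (leP c (f (X :&: Y))); lra.
Qed.

End SetFunctions.

Section WeightSystems.
Variables (T : finType) (weight : {set T} -> nat) (k b : nat).

Definition weight_system : {set {set T}} := [set S | (weight S <= b)%N]%SET.

Hypothesis weight_insert : forall (S : {set T}) (u : T),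
  u \notin S -> (weight (S :|: [set u]%SET) <= weight S + k)%N.
Hypothesis weight_delete : forall S Y : {set T},
  Y \subset S -> (weight (S :\: Y) + #|Y| <= weight S)%N.

Lemma independence_weight_system :
  (weight set0 <= b)%N -> independence_system weight_system.
Proof.
move=> weight0; split=> [|A B AB]; first by exists set0; rewrite inE.
rewrite !inE; apply: leq_trans; rewrite -(setDDK AB).
by apply: leq_trans (weight_delete (subsetDl B A)); rewrite leq_addr.
Qed.

(* Deleting k elements makes room for any insertion. *)
Lemma extendible_weight_system :
  (weight set0 <= b)%N -> extendible_system k weight_system.
Proof.
move=> weight0; split; first exact: independence_weight_system.
move=> A B u AB BI uB AuI.
have [kBA|/ltnW kBA] := leqP k #|B :\: A|; last first.
  by exists (B :\: A); rewrite (setDDK AB).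
have /set0Pn[Y] : [set Y : {set T} | Y \subset B :\: A & #|Y| == k] != set0.
  by rewrite -card_gt0 cards_draws bin_gt0.
rewrite inE => /andP[YBA /eqP Yk]; exists Y; rewrite YBA Yk; split=> //.
have YB : Y \subset B := subset_trans YBA (subsetDl B A).
move: BI; rewrite !inE; apply: leq_trans.
apply: leq_trans (weight_delete YB); rewrite Yk.
by apply: weight_insert; rewrite inE (negbTE uB) andbF.
Qed.

End WeightSystems.

Lemma sum_count_le (R : numDomainType) (J : finType) (S : Type)
    (p : J -> pred S) (B : R) (s : seq S) :
  (forall x, #|[set j | p j x]|%:R <= B) ->
  \sum_j (count (p j) s)%:R <= (size s)%:R * B.
Proof.
move=> rare; elim: s => [|x s IHs] /=; first by rewrite big1 ?mul0r.
under eq_bigr do rewrite natrD.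
rewrite big_split /= -natr1 mulrDl mul1r addrC lerD//.
by rewrite -natr_sum -big_mkcond sum1dep_card.
Qed.

Section OracleTrees.
Variables (R : realType) (T : finType).
Implicit Types (tr : oracle_tree R T) (f : {set T} -> R) (I : {set {set T}}).

Definition same_answers f f' I I' (X : {set T}) : Prop :=
  f X = f' X /\ (X \in I) = (X \in I').

Fixpoint queries tr f I : seq {set T} :=
  match tr with
  | Output _ => [::]
  | ValueQuery X next => X :: queries (next (f X)) f I
  | IndepQuery X next => X :: queries (next (X \in I)) f I
  end.

Lemma size_queries tr f I : size (queries tr f I) = query_count tr f I.
Proof. by elim: tr => //= X next IHnext; rewrite IHnext. Qed.

Lemma eq_run tr f f' I I' :
  {in queries tr f' I', forall X, same_answers f f' I I' X} ->
  run tr f I = run tr f' I'.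
Proof.
elim: tr => //= X next IHnext eq_on; have [fX IX] := eq_on X (mem_head _ _).
- by rewrite fX; apply: IHnext => Y Yq; apply: eq_on; rewrite inE Yq orbT.
- by rewrite IX; apply: IHnext => Y Yq; apply: eq_on; rewrite inE Yq orbT.
Qed.

Lemma value_run_le tr f f' I I' (differ : pred {set T}) (v : R) :
  (forall X, ~~ differ X -> same_answers f f' I I' X) ->
  (forall X, f X <= 1) -> 0 <= v -> f' (run tr f' I') <= v ->
  f (run tr f I) <=
    v + (count differ (run tr f' I' :: queries tr f' I'))%:R.
Proof.
move=> same f_le1 v_ge0 run_le; set answers := _ :: _.
have [some_differ|/hasPn none] := boolP (has differ answers).
  by rewrite (le_trans (f_le1 _))// ler_wpDl// ler1n -has_count.
rewrite (@eq_run tr f f' I I') => [|X Xq]; last first.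
  by apply: same; apply: none; rewrite inE Xq orbT.
by have [-> _] := same _ (none _ (mem_head _ _)); rewrite ler_wpDr.
Qed.

Lemma sum_value_run_le (J : finType) tr f' I'
    (f : J -> {set T} -> R) (I : J -> {set {set T}})
    (differ : J -> pred {set T}) (v B : R) (q : nat) :
  (forall j X, ~~ differ j X -> same_answers (f j) f' (I j) I' X) ->
  (forall X, #|[set j | differ j X]|%:R <= B) ->
  (forall j X, f j X <= 1) -> 0 <= v -> f' (run tr f' I') <= v ->
  (query_count tr f' I' <= q)%N ->
  \sum_j f j (run tr (f j) (I j)) <= #|J|%:R * v + q.+1%:R * B.
Proof.
move=> same rare f_le1 v_ge0 run_le tr_q.
have B_ge0 : 0 <= B := le_trans (ler0n _ _) (rare set0).
apply: le_trans (ler_sum _ (fun j _ =>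
  value_run_le (same j) (f_le1 j) v_ge0 run_le)) _.
rewrite big_split /= sumr_const -[v *+ _]mulr_natl lerD2l.
apply: le_trans (sum_count_le (_ :: _) rare) _.
by rewrite ler_wpM2r// ler_nat /= ltnS size_queries.
Qed.

End OracleTrees.

Section RandomizedAlgorithms.
Variables (R : realType) (T : finType) (A : rand_algorithm R T).
Implicit Types (f g : {set T} -> R) (I : {set {set T}}).

Lemma measurable_fun_run f g I :
  measurable_fun [set: seed A] (fun w => g (run (strategy w) f I)).
Proof.
move=> _ Y mY; rewrite classical_sets.setTI.
rewrite (_ : (_ @^-1` Y)%classic =
    (\bigcup_(S in [set S | Y (g S)])
       [set w | run (strategy w) f I = S])%classic).
  apply: fin_bigcup_measurable; first exact: finite_finset.
  by move=> S _; apply: measurable_run.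
apply/seteqP; split=> w /=; first by move=> Yw; exists (run (strategy w) f I).
by case=> S /= YS run_S; rewrite run_S.
Qed.

(* Yao's principle: averaging over a family of instances can be done first for
   each value of the seed. *)
Lemma expected_value_family_le (J : finType) (f : J -> {set T} -> R)
    (I : J -> {set {set T}}) (u v : R) :
  (0 < #|J|)%N -> (forall j, nonneg_setfun (f j)) ->
  (forall j, u%:E <= expected_value A (f j) (I j))%E ->
  (forall w : seed A,
     \sum_j f j (run (strategy w) (f j) (I j)) <= #|J|%:R * v) ->
  u <= v.
Proof.
move=> J_gt0 f_ge0 u_le le_v; rewrite -(@ler_pM2l _ #|J|%:R) ?ltr0n//.
rewrite -lee_fin.
apply: (@le_trans _ _ (\sum_j expected_value A (f j) (I j))%E).
  by rewrite mulr_natl -sumr_const -sumEFin; apply: lee_sum => j _; apply: u_le.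
rewrite /expected_value expectation.unlock -ge0_integral_sum//; last 2 first.
- by move=> j; apply/measurable_EFinP; apply: measurable_fun_run.
- by move=> j w _; rewrite lee_fin f_ge0.
apply: (@le_trans _ _ (\int[seed_law A]_w (#|J|%:R * v)%:E)%E).
  apply: ge0_le_integral => //.
  - by move=> w _; apply: sume_ge0 => j _; rewrite lee_fin f_ge0.
  - apply: emeasurable_sum => j; apply/measurable_EFinP.
    exact: measurable_fun_run.
  - by move=> w _; rewrite sumEFin lee_fin.
by rewrite integral_cst// [X in (_ * X)%E](probability_setT (seed_law A)) mule1.
Qed.

End RandomizedAlgorithms.

Lemma is_opt_exists (R : realType) (T : finType) (f : {set T} -> R)
    (I : {set {set T}}) (S : {set T}) : S \in I -> exists O, is_opt f I O.
Proof.
move=> SI; case: (arg_maxP f SI) => O OI O_max.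
by exists O; split=> // S' S'I; apply: O_max.
Qed.

Section HiddenInstance.
Variables (R : realType) (T : finType) (rho eta : R) (k t m : nat).
Implicit Types (H S X Y : {set T}).

(* Geometric up to [t], and then affine with the last slope
   [rho ^+ t.+1 - rho ^+ t], which preserves convexity. *)
Definition decay (x : nat) : R := rho ^+ minn x t * (1 - (1 - rho) *+ (x - t)).

Definition residual H S : R := decay #|S :&: H| * rho ^+ #|S :\: H|.

Definition hidden_value H S : R := 1 - Num.max eta (residual H S).

(* [y + min(x, t) + max(x - t, 0) / k] multiplied by [k], hence a natural
   number. *)
Definition hidden_weight H S : nat :=
  (k * (#|S :\: H| + minn #|S :&: H| t) + (#|S :&: H| - t))%N.

Definition hidden_system H : {set {set T}} :=
  weight_system (hidden_weight H) (k * m).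

Lemma hidden_weight_insert H S u : (0 < k)%N -> u \notin S ->
  (hidden_weight H (S :|: [set u]%SET) <= hidden_weight H S + k)%N.
Proof.
move=> k_gt0 uS; rewrite /hidden_weight !setDE !cardsIU1// inE.
by case: (u \in H); nia.
Qed.

Lemma hidden_weight_delete H S Y : (0 < k)%N -> Y \subset S ->
  (hidden_weight H (S :\: Y) + #|Y| <= hidden_weight H S)%N.
Proof.
move=> k_gt0 YS; rewrite /hidden_weight -(cardsID H Y) ![_ :\: H]setDE.
by rewrite -!(cardsDI _ YS); nia.
Qed.

Lemma hidden_system_extendible H :
  (0 < k)%N -> extendible_system k (hidden_system H).
Proof.
move=> k_gt0; apply: extendible_weight_system.
- by move=> S u; apply: hidden_weight_insert.
- by move=> S Y; apply: hidden_weight_delete.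
- by rewrite /hidden_weight set0I set0D cards0 min0n addn0 muln0.
Qed.

Lemma decay_small x : (x <= t)%N -> decay x = rho ^+ x.
Proof.
by move=> xt; rewrite /decay (minn_idPl xt) (eqP xt) mulr0n subr0 mulr1.
Qed.

Lemma residual_set0 S : residual set0 S = rho ^+ #|S|.
Proof. by rewrite /residual setI0 cards0 setD0 decay_small// mul1r. Qed.

Lemma residual_self H : residual H H = decay #|H|.
Proof. by rewrite /residual setIid setDv cards0 mulr1. Qed.

Lemma mem_hidden_system_set0 S :
  (0 < k)%N -> (S \in hidden_system set0) = (#|S| <= m)%N.
Proof.
move=> k_gt0; rewrite inE /hidden_weight setI0 cards0 setD0 min0n !addn0.
by rewrite leq_pmul2l.
Qed.

Lemma mem_hidden_system_self H :
  (H \in hidden_system H) = (k * minn #|H| t + (#|H| - t) <= k * m)%N.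
Proof. by rewrite inE /hidden_weight setIid setDv cards0. Qed.

Lemma decayS x : decay x.+1 = decay x - (1 - rho) * rho ^+ minn x t.
Proof.
rewrite /decay; have [tx|xt] := leqP t x.
  by rewrite (minn_idPr _) ?(leqW tx)// subSn// mulrSr; ring.
by rewrite (minn_idPl xt) (eqP xt) (eqP (ltnW xt)) !mulr0n exprS; ring.
Qed.

Lemma hidden_value_le1 H S : 0 <= eta -> hidden_value H S <= 1.
Proof. by move=> eta_ge0; rewrite lerBlDr lerDl le_max eta_ge0. Qed.

Hypotheses (rho_ge0 : 0 <= rho) (rho_le1 : rho <= 1).

Lemma decay_nonincreasing : nonincreasing_seq decay.
Proof.
apply/nonincreasing_seqP => x; rewrite decayS lerBlDr lerDl.
by rewrite mulr_ge0 ?exprn_ge0 ?subr_ge0.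
Qed.

Lemma decay_le1 x : decay x <= 1.
Proof. by rewrite (le_trans (decay_nonincreasing (leq0n x)))// decay_small. Qed.

Lemma decay_convex : convex_seq decay.
Proof.
move=> x; rewrite !decayS.
have : rho ^+ minn x.+1 t <= rho ^+ minn x t by apply: ler_wiXn2l => //; lia.
have : 0 <= 1 - rho by rewrite subr_ge0.
by nra.
Qed.

Lemma expr_nonincreasing : nonincreasing_seq (GRing.exp rho).
Proof. by move=> x y xy; apply: ler_wiXn2l. Qed.

Section HiddenValue.
Variable H : {set T}.
Hypothesis H_small : (1 - rho) *+ #|H| <= 1.

Lemma decay_setI_ge0 : nonneg_setfun (fun S => decay #|S :&: H|).
Proof.
move=> S; rewrite /decay mulr_ge0 ?exprn_ge0// subr_ge0.
apply: le_trans H_small; apply: ler_wpMn2l; first by rewrite subr_ge0.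
by rewrite (leq_trans (leq_subr _ _))// subset_leq_card// subsetIr.
Qed.

Lemma expr_setD_ge0 : nonneg_setfun (fun S => rho ^+ #|S :\: H|).
Proof. by move=> S; rewrite exprn_ge0. Qed.

Lemma antimonotone_decay_setI : antimonotone (fun S => decay #|S :&: H|).
Proof.
apply: (antimonotone_setI (f := fun S => decay #|S|)).
exact/antimonotone_card/decay_nonincreasing.
Qed.

Lemma antimonotone_expr_setD : antimonotone (fun S => rho ^+ #|S :\: H|).
Proof.
apply: (antimonotone_setD (f := fun S => rho ^+ #|S|)).
exact/antimonotone_card/expr_nonincreasing.
Qed.

Lemma residual_antimonotone : antimonotone (residual H).
Proof.
exact: antimonotoneM decay_setI_ge0 expr_setD_ge0
  antimonotone_decay_setI antimonotone_expr_setD.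
Qed.

Lemma residual_supermodular : supermodular (residual H).
Proof.
apply: (supermodularM decay_setI_ge0 expr_setD_ge0
  antimonotone_decay_setI antimonotone_expr_setD).
- apply: (supermodular_setI (f := fun S => decay #|S|)).
  exact/supermodular_card/decay_convex.
- apply: (supermodular_setD (f := fun S => rho ^+ #|S|)).
  exact/supermodular_card/convex_seq_expr.
Qed.

Lemma hidden_instance_valid : (0 < k)%N -> eta <= 1 ->
  valid_instance k (hidden_value H) (hidden_system H).
Proof.
move=> k_gt0 eta_le1; split.
- move=> S; rewrite subr_ge0 ge_max eta_le1 mulr_ile1 ?decay_le1 ?exprn_ile1//.
    exact: decay_setI_ge0.
  exact: expr_setD_ge0.
- move=> X Y /residual_antimonotone res_le; rewrite lerB// ge_max !le_max.
  by rewrite lexx res_le orbT.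
- exact/submodular_subl_maxr/residual_supermodular/residual_antimonotone.
- exact: hidden_system_extendible.
Qed.

End HiddenValue.

Lemma same_answers_set0_small H S : (0 < k)%N -> (#|S :&: H| <= t)%N ->
  same_answers (hidden_value H) (hidden_value set0)
    (hidden_system H) (hidden_system set0) S.
Proof.
move=> k_gt0 small; split.
  rewrite /hidden_value residual_set0 /residual decay_small//.
  by rewrite -exprD cardsID.
rewrite mem_hidden_system_set0// inE /hidden_weight (minn_idPl small).
by rewrite (eqP small) addn0 addnC cardsID leq_pmul2l.
Qed.

(* Both values are truncated at [1 - eta] and both systems exclude [S]. *)
Lemma same_answers_set0_large H S : (0 < k)%N ->
  (m < #|S :\: H|)%N -> rho ^+ #|S :\: H| <= eta ->
  same_answers (hidden_value H) (hidden_value set0)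
    (hidden_system H) (hidden_system set0) S.
Proof.
move=> k_gt0 infeasible truncated.
have leS : (#|S :\: H| <= #|S|)%N by rewrite subset_leq_card// subsetDl.
split; last first.
  rewrite mem_hidden_system_set0// (leqNgt #|S|) (leq_trans infeasible)//.
  rewrite inE leqNgt /hidden_weight; apply/negbTE; rewrite negbK.
  by rewrite mulnDr -addnA ltn_addr// ltn_pmul2l.
rewrite /hidden_value residual_set0 !(max_idPl _)//.
  exact: le_trans (expr_nonincreasing leS) truncated.
apply: le_trans truncated.
by rewrite ler_piMl ?exprn_ge0 ?decay_le1.
Qed.

End HiddenInstance.

Section RealBounds.
Variable R : realType.

Lemma expRN_le_inv (x : R) : -1 < x -> expR (- x) <= (1 + x)^-1.
Proof.
move=> x_gt; rewrite expRN lef_pV2 ?posrE ?expR_gt0 ?expR_ge1Dx//.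
by lra.
Qed.

Lemma expR_le_quadratic (x : R) :
  0 <= x -> x <= 1 / 2 -> expR x <= 1 + x + 2 * x ^+ 2.
Proof.
move=> x_ge0 x_small; have e_gt0 := expR_gt0 x.
have : (1 - x) * expR x <= 1.
  by rewrite -ler_pdivlMr// div1r -expRN expR_ge1Dx.
by nra.
Qed.

Lemma near_poly_le_expR (p : {poly R}) (a : R) :
  0 < a -> \forall x \near +oo, p.[x] <= expR (a * x).
Proof.
move=> a_gt0; set d := size p.
pose b := a ^+ d.+1 / (d.+1)`!%:R; pose K := \sum_(i < d) `|p`_i|.
have b_gt0 : 0 < b by rewrite divr_gt0 ?exprn_gt0 ?ltr0n ?fact_gt0.
near=> x.
have x_ge1 : 1 <= x by near: x; apply: nbhs_pinfty_ge.
have K_le : K <= x * b.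
  by rewrite -ler_pdivrMr//; near: x; apply: nbhs_pinfty_ge; rewrite num_real.
have x_ge0 : 0 <= x by lra.
apply: (@le_trans _ _ (K * x ^+ d)).
  rewrite horner_coef mulr_suml ler_sum// => i _.
  rewrite (le_trans (ler_norm _))// normrM normrX (ger0_norm x_ge0).
  by rewrite ler_wpM2l// ler_weXn2l// ltnW.
apply: (@le_trans _ _ (x * b * x ^+ d)).
  by rewrite ler_wpM2r// exprn_ge0.
have -> : x * b * x ^+ d = (a * x) ^+ d.+1 / (d.+1)`!%:R.
  by rewrite exprMn (exprS x) /b; ring.
apply: le_trans (expR_ge1Dxn d (mulr_ge0 (ltW a_gt0) x_ge0)).
by rewrite lerDr.
Unshelve. all: by end_near. Qed.

Lemma near_natpoly_expRN_le (p : {poly nat}) (a b : R) : 0 < a -> 0 < b ->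
  \forall n \near \oo%classic, p.[n]%:R * expR (- (a * n%:R)) <= b.
Proof.
move=> a_gt0 b_gt0; pose q : {poly R} := b^-1 *: map_poly (GRing.natmul 1) p.
have q_le : \forall n \near \oo%classic, q.[n%:R] <= expR (a * n%:R).
  exact: cvgr_idn (near_poly_le_expR q a_gt0).
near=> n; rewrite expRN ler_pdivrMr ?expR_gt0// -ler_pdivrMl//.
by rewrite -horner_map -hornerZ; near: n.
Unshelve. all: by end_near. Qed.

Lemma near_div_natrM_lt (k : nat) (x e : R) : (0 < k)%N -> 0 < e ->
  \forall r \near \oo%classic, x / (k * r)%:R < e.
Proof.
move=> k_gt0 e_gt0; near=> r.
have r_gt0 : (0 < r)%N by near: r; apply: nbhs_infty_gt.
rewrite ltr_pdivrMr ?ltr0n ?muln_gt0 ?k_gt0// -ltr_pdivrMl//.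
apply: (@lt_le_trans _ _ r%:R); last by rewrite ler_nat leq_pmull.
by near: r; apply: nbhs_infty_gtr.
Unshelve. all: by end_near. Qed.

Lemma sum_expR_mem_le (J : finType) (B : {set J}) (lam : R) : (0 < #|J|)%N ->
  \sum_j expR (lam * (j \in B)%:R) <=
  #|J|%:R * expR ((expR lam - 1) * (#|B|%:R / #|J|%:R)).
Proof.
move=> J_gt0; have J0 : (#|J|%:R : R) != 0 by rewrite pnatr_eq0 -lt0n.
have -> : \sum_j expR (lam * (j \in B)%:R) =
    #|J|%:R * (1 + (expR lam - 1) * (#|B|%:R / #|J|%:R)).
  transitivity (\sum_(j : J) (1 + (expR lam - 1) * (j \in B)%:R)).
    apply: eq_bigr => j _.
    by case: (j \in B); rewrite ?mulr1 ?mulr0 ?expR0; ring.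
  rewrite big_split /= sumr_const -mulr_sumr -natr_sum -big_mkcond sum1_card.
  by field.
by rewrite ler_wpM2l ?expR_ge1Dx.
Qed.

Lemma card_tail_le_sum_expR (J : finType) (F : J -> R) (lam a : R) :
  0 <= lam ->
  #|[set j | a <= F j]%SET|%:R * expR (lam * a) <= \sum_j expR (lam * F j).
Proof.
move=> lam_ge0; rewrite -sum1dep_card natr_sum mulr_suml big_mkcond /=.
apply: ler_sum => j _; case: ifP => [a_le|_]; last exact: expR_ge0.
by rewrite mul1r ler_expR ler_wpM2l.
Qed.

End RealBounds.

Section Transversals.
Variables (R : realType) (I J T : finType) (e : I -> J -> T).
Hypothesis e_bij : bijective (uncurry e).
Implicit Types (c : {ffun I -> J}) (X : {set T}).

Definition block_transversal c : {set T} := [set e i (c i) | i : I]%SET.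

Definition slice X (i : I) : {set J} := [set j | e i j \in X]%SET.

Lemma block_transversal_inj c : injective (fun i => e i (c i)).
Proof.
move=> i i' eq_e; have /(_ (i, c i) (i', c i')) := bij_inj e_bij.
by move=> /(_ eq_e)[].
Qed.

Lemma card_block_transversal c : #|block_transversal c| = #|I|.
Proof. by rewrite card_imset//; apply: block_transversal_inj. Qed.

Lemma card_setI_block_transversal c X :
  #|X :&: block_transversal c| = (\sum_i (c i \in slice X i))%N.
Proof.
rewrite setIC -sum1dep_card big_mkcondr big_imset /=; last first.
  by move=> i i' _ _; apply: block_transversal_inj.
by apply: eq_bigr => i _; rewrite inE; case: ifP.
Qed.

Lemma sum_card_slice X : (\sum_i #|slice X i|)%N = #|X|.
Proof.
under eq_bigr do rewrite -sum1dep_card big_mkcond.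
rewrite pair_big /= -sum1_card [RHS]big_mkcond (reindex (uncurry e)) //=.
  by apply: eq_bigr => -[i j].
exact: onW_bij.
Qed.

Hypothesis J_gt0 : (0 < #|J|)%N.

Lemma block_transversal_mgf (lam : R) X :
  \sum_c expR (lam * #|X :&: block_transversal c|%:R) <=
  #|{ffun I -> J}|%:R * expR ((expR lam - 1) * (#|X|%:R / #|J|%:R)).
Proof.
under eq_bigr do
  rewrite card_setI_block_transversal natr_sum mulr_sumr expR_sum.
rewrite -(bigA_distr_bigA (fun i j => expR (lam * (j \in slice X i)%:R))) /=.
rewrite -sum_card_slice natr_sum mulr_suml mulr_sumr expR_sum.
rewrite card_ffun natrX -prodr_const -big_split /=.
apply: ler_prod => i _; rewrite sum_expR_mem_le// andbT.
by apply: sumr_ge0 => j _; apply: expR_ge0.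
Qed.

(* Chernoff's method; as the mean is at most |I|, the part of
   [expR lam - 1 <= lam + 2 lam^2] that is not linear costs [2 lam^2 |I|]. *)
Lemma block_transversal_tail (lam d : R) X : 0 <= lam -> lam <= 1 / 2 ->
  #|[set c | #|X|%:R / #|J|%:R + d <=
             #|X :&: block_transversal c|%:R]%SET|%:R <=
  #|{ffun I -> J}|%:R * expR (2 * lam ^+ 2 * #|I|%:R - lam * d).
Proof.
move=> lam_ge0 lam_small; set mean : R := #|X|%:R / #|J|%:R.
have mean_le : mean <= #|I|%:R.
  rewrite /mean ler_pdivrMr ?ltr0n// -natrM ler_nat -card_prod.
  by rewrite (bij_eq_card e_bij) max_card.
have mean_ge0 : 0 <= mean by rewrite divr_ge0.
rewrite -(ler_pM2r (expR_gt0 (lam * (mean + d)))) -[leRHS]mulrA -expRD.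
apply: le_trans (card_tail_le_sum_expR _ _ lam_ge0) _.
apply: le_trans (block_transversal_mgf _ _) _.
rewrite ler_wpM2l// ler_expR -/mean.
have := expR_le_quadratic lam_ge0 lam_small; have := sqr_ge0 lam.
by nra.
Qed.

End Transversals.

Section HardFamily.
Variables (R : realType) (k r L : nat).
Hypotheses (k_gt0 : (0 < k)%N) (r_gt0 : (0 < r)%N) (L_gt0 : (0 < L)%N).

Definition resolution : nat := (k * r)%N.
Definition hidden_size : nat := (resolution * L)%N.
(* Chosen so that a set X with more than L elements in the hidden set, but less
   than twice the expected number |X| / block_size, has more than
   (resolution^2 + 1) L elements outside of the hidden set. *)
Definition block_size : nat := (2 * (resolution ^ 2 + 2))%N.
Definition budget : nat := (r.+1 * L)%N.
Definition rate : R := expR (- hidden_size%:R^-1).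
Definition residual_floor : R := expR (- resolution%:R).

Local Notation D := resolution.
Local Notation M := hidden_size.

Lemma resolution_gt0 : (0 < D)%N. Proof. by rewrite muln_gt0 k_gt0. Qed.

Lemma hidden_size_gt0 : (0 < M)%N.
Proof. by rewrite muln_gt0 resolution_gt0. Qed.

Lemma natr_hidden_size_gt0 : (0 : R) < M%:R.
Proof. by rewrite ltr0n hidden_size_gt0. Qed.

Lemma block_size_gt0 : (0 < block_size)%N.
Proof. by rewrite muln_gt0 addn_gt0 orbT. Qed.

Lemma rate_ge0 : 0 <= rate. Proof. exact: expR_ge0. Qed.

Lemma rate_le1 : rate <= 1.
Proof. by rewrite expR_le1 oppr_le0 invr_ge0. Qed.

Lemma rate_exp (n : nat) : rate ^+ n = expR (- (n%:R / M%:R)).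
Proof. by rewrite -expRM_natl mulrN. Qed.

Lemma residual_floor_le1 : residual_floor <= 1.
Proof. by rewrite expR_le1 oppr_le0. Qed.

Lemma residual_floor_le : residual_floor <= D%:R^-1.
Proof.
have D_gt0 : (0 : R) < D%:R by rewrite ltr0n resolution_gt0.
apply: le_trans (expRN_le_inv _) _; first by lra.
by rewrite lef_pV2 ?posrE; lra.
Qed.

Lemma rate_total_le1 (n : nat) : (n <= M)%N -> (1 - rate) *+ n <= 1.
Proof.
move=> nM; have M_gt0 := natr_hidden_size_gt0.
apply: (@le_trans _ _ ((1 - rate) * M%:R)).
  by rewrite -mulr_natr ler_wpM2l ?ler_nat// subr_ge0 rate_le1.
rewrite -ler_pdivlMr// div1r lerBlDl -lerBlDr.
exact: expR_ge1Dx.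
Qed.

Lemma rate_loss_ge : (M%:R + 1)^-1 <= 1 - rate.
Proof.
have M_gt0 := natr_hidden_size_gt0.
have : rate <= (1 + M%:R^-1)^-1.
  by apply: expRN_le_inv; apply: lt_trans (ltrN10 _) _; rewrite invr_gt0.
have -> : (1 + M%:R^-1)^-1 = 1 - (M%:R + 1)^-1 :> R by field; lra.
by lra.
Qed.

(* Since [1 - rate >= (M + 1)^-1], the decay is at most [(L + 1) / (M + 1)]. *)
Lemma decay_hidden_size_le : decay rate L M <= 2 / D%:R.
Proof.
have L_ge1 : (1 : R) <= L%:R by rewrite ler1n.
have LM : (L <= M)%N by rewrite leq_pmull// resolution_gt0.
have LM_real : (L%:R : R) <= M%:R by rewrite ler_nat.
have loss_ge0 : 0 <= 1 - (1 - rate) *+ (M - L).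
  by rewrite subr_ge0 rate_total_le1// leq_subr.
apply: (@le_trans _ _ (1 - (1 - rate) *+ (M - L))).
  by rewrite /decay ler_piMl// exprn_ile1 ?rate_ge0 ?rate_le1.
rewrite -mulr_natr natrB//.
apply: (@le_trans _ _ (1 - (M%:R + 1)^-1 * (M%:R - L%:R))).
  by rewrite lerB// ler_wpM2r ?subr_ge0// rate_loss_ge.
have -> : 1 - (M%:R + 1)^-1 * (M%:R - L%:R) = (L%:R + 1) / (M%:R + 1) :> R.
  by field; lra.
have -> : 2 / D%:R = 2 * L%:R / M%:R :> R.
  by rewrite [M%:R]natrM; field; rewrite !pnatr_eq0 -!lt0n L_gt0 resolution_gt0.
by rewrite ler_pdivrMr ?ltr_wpDl// mulrAC ler_pdivlMr; nra.
Qed.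

Section Instances.
Variable T : finType.
Implicit Types H S : {set T}.
Local Notation value := (@hidden_value R T rate residual_floor L).
Local Notation system := (@hidden_system T k L budget).

Lemma hard_instance_valid H :
  (#|H| <= M)%N -> valid_instance k (value H) (system H).
Proof.
move=> H_le; apply: hidden_instance_valid => //.
- exact: rate_ge0.
- exact: rate_le1.
- exact: rate_total_le1.
- exact: residual_floor_le1.
Qed.

Lemma hidden_set_independent H : #|H| = M -> H \in system H.
Proof.
move=> H_card; rewrite mem_hidden_system_self H_card.
by rewrite /budget /hidden_size /resolution; nia.
Qed.

Lemma value_hidden_set_ge H : #|H| = M -> 1 - 2 / D%:R <= value H H.
Proof.
move=> H_card; rewrite lerB// residual_self H_card ge_max decay_hidden_size_le.
rewrite andbT (le_trans residual_floor_le)// ler_peMl ?invr_ge0//.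
by rewrite ler1n.
Qed.

Lemma value_set0_le S : S \in system set0 ->
  value set0 S <= 1 - expR (- (1 / k%:R)) + D%:R^-1.
Proof.
rewrite mem_hidden_system_set0// => S_le.
have residual_ge :
    rate ^+ budget <= Num.max residual_floor (residual rate L set0 S).
  by rewrite residual_set0 le_max ler_wiXn2l ?orbT ?rate_ge0 ?rate_le1.
have rate_budget : rate ^+ budget = expR (- (1 / k%:R)) * expR (- D%:R^-1).
  rewrite rate_exp -expRD; congr expR.
  rewrite /budget /hidden_size /resolution !natrM -natr1; field.
  by rewrite !pnatr_eq0 -!lt0n k_gt0 r_gt0 L_gt0.
have loss_le : expR (- (1 / k%:R)) * D%:R^-1 <= D%:R^-1 :> R.
  by rewrite ler_piMl ?invr_ge0// expR_le1 oppr_le0 divr_ge0.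
have := ler_wpM2l (expR_ge0 (- (1 / k%:R) : R)) (expR_ge1Dx (- D%:R^-1 : R)).
by rewrite -rate_budget /hidden_value; lra.
Qed.

End Instances.

Section Family.
Variables (I J T : finType) (e : I -> J -> T).
Hypothesis e_bij : bijective (uncurry e).
Hypotheses (cardI : #|I| = M) (cardJ : #|J| = block_size).
Implicit Types (c : {ffun I -> J}) (X : {set T}).
Local Notation hidden := (block_transversal e).
Local Notation value := (@hidden_value R T rate residual_floor L).
Local Notation system := (@hidden_system T k L budget).

Definition correlated c X : bool :=
  #|X|%:R / #|J|%:R + L%:R / 2 <= #|X :&: hidden c|%:R :> R.

Let J_gt0 : (0 < #|J|)%N. Proof. by rewrite cardJ block_size_gt0. Qed.

Lemma uncorrelated_setD_gt c X :
  ~~ correlated c X -> (L < #|X :&: hidden c|)%N ->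
  (D ^ 2 * L + L < #|X :\: hidden c|)%N.
Proof.
rewrite /correlated -ltNge => uncorrelated large.
have J0 : (0 : R) < #|J|%:R by rewrite ltr0n J_gt0.
move: uncorrelated large; rewrite -(cardsID (hidden c) X).
move: #|_ :&: _| #|_ :\: _| => x y x_lt L_lt.
have : x%:R / 2 < (x + y)%:R / #|J|%:R :> R.
  by move: L_lt; rewrite -(ltr_nat R); lra.
rewrite ltr_pdivlMr// cardJ /block_size natrM mulrA mulfVK ?pnatr_eq0//.
by rewrite -natrM ltr_nat; nia.
Qed.

Lemma uncorrelated_same_answers c X : ~~ correlated c X ->
  same_answers (value (hidden c)) (value set0)
    (system (hidden c)) (system set0) X.
Proof.
move=> uncorrelated; have [small|large] := leqP #|X :&: hidden c| L.
  exact: same_answers_set0_small.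
have outside := uncorrelated_setD_gt uncorrelated large.
have M_gt0 := natr_hidden_size_gt0.
apply: same_answers_set0_large => //.
- exact: rate_ge0.
- exact: rate_le1.
- apply: leq_ltn_trans outside; rewrite /budget mulSn addnC leq_add2r.
  rewrite leq_mul2r (leq_trans (leq_pmull r k_gt0)) ?orbT//.
  by rewrite leq_pmulr// resolution_gt0.
- rewrite rate_exp ler_expR lerN2 ler_pdivlMr// -natrM ler_nat.
  by rewrite /hidden_size; move: outside; nia.
Qed.

Lemma correlated_rare X :
  #|[set c | correlated c X]%SET|%:R <=
  #|{ffun I -> J}|%:R * expR (- ((32 * D)%:R^-1 * L%:R)) :> R.
Proof.
have D_ge1 : (1 : R) <= D%:R by rewrite ler1n resolution_gt0.
(* The minimiser of [2 lam^2 M - lam L / 2]. *)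
pose lam : R := (8 * D%:R)^-1.
have lam_ge0 : 0 <= lam by rewrite invr_ge0; lra.
have lam_small : lam <= 1 / 2 by rewrite div1r lef_pV2 ?posrE; lra.
have exponentE : 2 * lam ^+ 2 * #|I|%:R - lam * (L%:R / 2) =
    - ((32 * D)%:R^-1 * L%:R).
  by rewrite cardI /lam (natrM R 32) [M%:R]natrM; field; lra.
by rewrite -exponentE; apply: block_transversal_tail.
Qed.

Lemma hard_family_ratio (A : rand_algorithm R T) (alpha : R) (q : nat) :
  (forall f I, valid_instance k f I ->
     forall w : seed A, (query_count (strategy w) f I <= q)%N) ->
  (forall f I, valid_instance k f I ->
     forall w : seed A, run (strategy w) f I \in I) ->
  0 < alpha ->
  (forall f I, valid_instance k f I -> forall OPT, is_opt f I OPT ->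
     ((f OPT / alpha)%:E <= expected_value A f I)%E) ->
  (1 - 2 / D%:R) / alpha <= 1 - expR (- (1 / k%:R)) + D%:R^-1 +
    q.+1%:R * expR (- ((32 * D)%:R^-1 * L%:R)).
Proof.
move=> few_queries indep alpha_gt0 approx.
have card_hidden c : #|hidden c| = M by rewrite card_block_transversal.
have valid c := hard_instance_valid (eq_leq (card_hidden c)).
have valid0 : valid_instance k (value set0) (system set0).
  by apply: hard_instance_valid; rewrite cards0.
apply: (expected_value_family_le (A := A) (J := {ffun I -> J})
  (f := fun c => value (hidden c)) (I := fun c => system (hidden c))).
- by rewrite card_ffun expn_gt0 J_gt0.
- by move=> c; have [] := valid c.
- move=> c; have self_indep := hidden_set_independent (card_hidden c).
  have [OPT OPT_max] := is_opt_exists (value (hidden c)) self_indep.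
  apply: le_trans (approx _ _ (valid c) _ OPT_max).
  rewrite lee_fin ler_wpM2r ?invr_ge0 ?(ltW alpha_gt0)//.
  apply: le_trans (value_hidden_set_ge (card_hidden c)) _.
  by have [_] := OPT_max; apply.
- move=> w; rewrite [leRHS]mulrDr [X in _ <= _ + X]mulrCA.
  apply: (sum_value_run_le uncorrelated_same_answers correlated_rare).
  + by move=> c X; apply/hidden_value_le1/expR_ge0.
  + by rewrite addr_ge0 ?invr_ge0// subr_ge0 expR_le1 oppr_le0 divr_ge0.
  + exact/value_set0_le/indep.
  + exact: few_queries.
Qed.

End Family.

End HardFamily.

Lemma mxvec_index_bij (m n : nat) : bijective (uncurry (@mxvec_index m n)).
Proof. by have [g gK Kg] := curry_mxvec_bij m n; exists g => x; auto. Qed.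

Lemma exists_rare_detection (R : realType) (k r : nat) (p : {poly nat}) :
  (0 < k)%N -> (0 < r)%N -> exists L, (0 < L)%N /\
    p.[(hidden_size k r L * block_size k r)%N].+1%:R *
      expR (- ((32 * resolution k r)%:R^-1 * L%:R)) <=
    (resolution k r)%:R^-1 :> R.
Proof.
move=> k_gt0 r_gt0.
pose size_poly := (resolution k r * block_size k r)%N *: 'X : {poly nat}.
have : \forall L \near \oo%classic,
    (p \Po size_poly + 1).[L]%:R *
      expR (- ((32 * resolution k r)%:R^-1 * L%:R)) <=
    (resolution k r)%:R^-1 :> R.
  by apply: near_natpoly_expRN_le; rewrite invr_gt0 ltr0n !muln_gt0 k_gt0 r_gt0.
move/(filterI (nbhs_infty_gt 0))/filter_ex => [L [L_gt0]].
rewrite hornerD horner_comp hornerZ hornerX hornerC.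
by rewrite natrDE addn1 natrME mulnAC => detect_le; exists L.
Qed.

Theorem theorem44 (R : realType) (k : nat) (eps : R) :
  (0 < k)%N -> 0 < eps ->
  ~ exists A : algorithm R,
      [/\ polynomial_queries k A, outputs_independent k A
        & approximation_ratio k A ((1 - expR (- (1 / k%:R)))^-1 - eps)].
Proof.
move=> k_gt0 eps_gt0 [A [[p few_queries] indep [alpha_gt0 approx]]].
set beta := 1 - expR (- (1 / k%:R)) in alpha_gt0 approx.
set alpha := beta^-1 - eps in alpha_gt0 approx.
have beta_gt0 : 0 < beta by rewrite subr_gt0 expR_lt1 oppr_lt0 divr_gt0 ?ltr0n.
have alpha_beta : alpha * beta = 1 - eps * beta.
  by rewrite /alpha mulrBl mulVf ?gt_eqF.
have [r [r_gt0 loss_lt]] :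
    exists r, (0 < r)%N /\ (2 + 2 * alpha) / (resolution k r)%:R < eps * beta.
  have := near_div_natrM_lt (2 + 2 * alpha) k_gt0 (mulr_gt0 eps_gt0 beta_gt0).
  by move/(filterI (nbhs_infty_gt 0)); apply: filter_ex.
set delta : R := (resolution k r)%:R^-1 in loss_lt.
have [L [L_gt0 detect_le]] := exists_rare_detection R p k_gt0 r_gt0.
have gap := hard_family_ratio k_gt0 r_gt0 L_gt0
  (mxvec_index_bij (hidden_size k r L) (block_size k r)) (card_ord _)
  (card_ord _) (few_queries _) (indep _) alpha_gt0 (approx _).
move: gap; rewrite ler_pdivrMr// -/delta -/beta => gap.
have : 1 - 2 * delta <= (beta + delta + delta) * alpha.
  by apply: le_trans gap _; rewrite ler_pM2r// lerD2l.
by lra.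
Qed.
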